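(* A mixed graph $G=(V,D,B)$ is HTC-identifiable if and only if the following procedure terminates with $S=V$: initialize $S=\{v\in V:\mathrm{pa}(v)=\emptyset\}$; repeatedly, for $v=1,2,\dots,m$ in turn, if $v\notin S$, set $A=\big(S\cup(V\setminus\mathrm{htr}(v))\big)\setminus(\{v\}\cup\mathrm{sib}(v))$ and add $v$ to $S$ whenever the maximum flow in $G_{\mathrm{flow}}(v,A)$ has size $|\mathrm{pa}(v)|$; stop when $S=V$ or when a full pass over $v=1,\dots,m$ makes no change to $S$.
   Context: A mixed graph is $G=(V,D,B)$ with $V=[m]$, $D$ directed edges $v\to w$, $B$ symmetric bidirected edges $v\leftrightarrow w$, no self-loops. $\mathrm{pa}(v)=\{w:w\to v\in D\}$, $\mathrm{sib}(v)=\{w:w\leftrightarrow v\in B\}$. A half-trek from $y$ to $w$ is a path $y\leftrightarrow w_0\to w_1\to\cdots\to w_r=w$ (left side $\{y\}$, right side $\{w_0,\dots,w_r\}$) or $y\to w_1\to\cdots\to w_r=w$, $r\ge0$ (left side $\{y\}$, right side $\{y,w_1,\dots,w_r\}$); nodes may repeat. $\mathrm{htr}(v)$ is the set of $w\in V\setminus(\{v\}\cup\mathrm{sib}(v))$ reachable from $v$ by a half-trek. A system of half-treks from $X$ to $Y$: half-treks with distinct sources forming $X$ and distinct targets forming $Y$; no sided intersection: pairwise disjoint left sides and pairwise disjoint right sides. $Y$ satisfies the half-trek criterion w.r.t. $v$ if $|Y|=|\mathrm{pa}(v)|$, $Y\cap(\{v\}\cup\mathrm{sib}(v))=\emptyset$,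 and there is a system of half-treks with no sided intersection from $Y$ to $\mathrm{pa}(v)$. $G$ is HTC-identifiable if there exist $(Y_v:v\in V)$, each satisfying the half-trek criterion w.r.t. $v$, and a total order $\prec$ on $V$ with $w\prec v$ whenever $w\in Y_v\cap\mathrm{htr}(v)$. Flows: in a directed graph with source $s$, sink $t$, node capacities and edge capacities, a flow is a nonnegative edge function respecting edge capacities and, at each node $x\ne s,t$, conservation $\sum_u f(u,x)=\sum_w f(x,w)$ with this value at most the node capacity; its size is the total flow out of $s$. $G_{\mathrm{flow}}(v,A)$ has nodes $s,t$, $L(a)$ for $a\in A$, $R(w)$ for $w\in V$; edges $s\to L(a)$ and $L(a)\to R(a)$ ($a\in A$), $L(a)\to R(w)$ whenever $a\leftrightarrow w\in B$, $R(w)\to R(u)$ whenever $w\to u\in D$, and $R(w)\to t$ for $w\in\mathrm{pa}(v)$. All edges and $s,t$ have capacity $\infty$, all other nodes capacity $1$. *)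

(* Defs.v *)
From HB Require Import structures.
From mathcomp Require Import all_boot all_order all_algebra.
From Stdlib Require Import ClassicalEpsilon.
Set Implicit Arguments. Unset Strict Implicit. Unset Printing Implicit Defensive.
Import Order.TTheory GRing.Theory Num.Theory.

Definition asbool (P : Prop) : bool :=
  if excluded_middle_informative P then true else false.

(* A half-trek from ht_src:
   - ht_bi = true : ht_src <-> w0 -> w1 -> ... -> wr, ht_nodes = [w0;...;wr]
   - ht_bi = false: ht_src -> w1 -> ... -> wr, ht_nodes = [w1;...;wr] (r >= 0) *)
Record halftrek (m : nat) := HalfTrek
  { ht_src : 'I_m; ht_bi : bool; ht_nodes : seq 'I_m }.
Arguments ht_src {m}. Arguments ht_bi {m}. Arguments ht_nodes {m}.

Section MixedGraph.
(* Vertex set V = 'I_m ; D w u means the directed edge w -> u ;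
   B w u means the bidirected edge w <-> u. *)
Variables (m : nat) (D B : rel 'I_m).

Definition pa (v : 'I_m) : {set 'I_m} := [set w | D w v].
Definition sib (v : 'I_m) : {set 'I_m} := [set w | B w v].

Definition is_halftrek (h : halftrek m) : bool :=
  if ht_bi h then
    (if ht_nodes h is w0 :: r then B (ht_src h) w0 && path D w0 r else false)
  else path D (ht_src h) (ht_nodes h).

Definition ht_tgt (h : halftrek m) : 'I_m := last (ht_src h) (ht_nodes h).
Definition ht_left (h : halftrek m) : seq 'I_m := [:: ht_src h].
Definition ht_right (h : halftrek m) : seq 'I_m :=
  if ht_bi h then ht_nodes h else ht_src h :: ht_nodes h.

Definition htr (v : 'I_m) : {set 'I_m} :=
  [set w | (w != v) && (w \notin sib v) &&
           asbool (exists h : halftrek m,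
                     [&& is_halftrek h, ht_src h == v & ht_tgt h == w])].

Definition ht_system (hs : seq (halftrek m)) (X Y : {set 'I_m}) : Prop :=
  all is_halftrek hs /\
  uniq (map ht_src hs) /\ [set x in map ht_src hs] = X /\
  uniq (map ht_tgt hs) /\ [set x in map ht_tgt hs] = Y /\
  pairwise (fun h1 h2 => [disjoint ht_left h1 & ht_left h2] &&
                             [disjoint ht_right h1 & ht_right h2]) hs.

Definition htc (v : 'I_m) (Y : {set 'I_m}) : Prop :=
  [/\ #|Y| = #|pa v|, Y :&: (v |: sib v) = set0 &
      exists hs : seq (halftrek m), ht_system hs Y (pa v)].

Definition HTC_identifiable : Prop :=
  exists Ys : 'I_m -> {set 'I_m},
    (forall v, htc v (Ys v)) /\
    exists lt : rel 'I_m,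
      [/\ irreflexive lt, transitive lt,
          (forall v w, v != w -> lt v w || lt w v) &
          (forall v w, w \in Ys v :&: htr v -> lt w v)].

(* The flow network G_flow(v, A).  Nodes: inl true = s, inl false = t,
   inr (inl a) = L(a), inr (inr w) = R(w).  Nodes L(a) with a \notin A
   are isolated (carry no edges). *)
Definition fnode := (bool + ('I_m + 'I_m))%type.
Definition fs : fnode := inl true.
Definition ft : fnode := inl false.

Definition fedge (v : 'I_m) (A : {set 'I_m}) : rel fnode :=
  fun x y =>
    match x, y with
    | inl true, inr (inl a) => a \in A
    | inr (inl a), inr (inr w) => (a \in A) && ((a == w) || B a w)
    | inr (inr w), inr (inr u) => D w u
    | inr (inr w), inl false => w \in pa v
    | _, _ => false
    end.

Section Flows.
Variable R : realFieldType.
Local Open Scope ring_scope.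

(* Edge capacities and capacities of s,t are infinite; other nodes have
   capacity 1.  An edge function is a function on pairs vanishing off edges. *)
Definition is_flow (v : 'I_m) (A : {set 'I_m}) (f : fnode -> fnode -> R) : Prop :=
  [/\ forall x y, 0 <= f x y,
      forall x y, ~~ fedge v A x y -> f x y = 0 &
      forall x, x != fs -> x != ft ->
        \sum_(u : fnode) f u x = \sum_(w : fnode) f x w /\
        \sum_(w : fnode) f x w <= 1].

Definition flow_size (f : fnode -> fnode -> R) : R := \sum_(w : fnode) f fs w.

Definition max_flow_is (v : 'I_m) (A : {set 'I_m}) (k : nat) : Prop :=
  (exists f, is_flow v A f /\ flow_size f = k%:R) /\
  (forall f, is_flow v A f -> flow_size f <= k%:R).

Definition algA (S : {set 'I_m}) (v : 'I_m) : {set 'I_m} :=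
  (S :|: ~: htr v) :\: (v |: sib v).

Definition alg_step (S : {set 'I_m}) (v : 'I_m) : {set 'I_m} :=
  if v \in S then S
  else if asbool (max_flow_is v (algA S v) #|pa v|) then v |: S else S.

Definition alg_pass (S : {set 'I_m}) : {set 'I_m} :=
  foldl alg_step S (enum 'I_m).

Definition alg_init : {set 'I_m} := [set v | pa v == set0].

(* The procedure terminates with S = V: after k passes S = V, and no
   earlier pass left S unchanged (so the procedure had not stopped). *)
Definition procedure_succeeds : Prop :=
  exists k : nat,
    iter k alg_pass alg_init = setT /\
    (forall j, (j < k)%N -> alg_pass (iter j alg_pass alg_init) != iter j alg_pass alg_init).

End Flows.
End MixedGraph.

(* Main.v *)
(* The heart of the matter is that the maximal flow into pa(v) has size |pa(v)|
   iff some Y in A admits a system of half-treks to pa(v) without sided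
   intersection.  Shortening the right sides to simple paths and counting edges
   turns a system into a flow.  Conversely, a flow of size |pa(v)| completes to
   a fractional matching of every vertex u with a predecessor of R(u) (or with
   R(u) itself when u is not in pa(v)) in which no vertex is matched to a member
   of pa(v); Hall's theorem makes it integral, and following it backwards from
   pa(v) yields the half-treks.  Given this, the order in which the procedure
   adds vertices is a valid total order, and the procedure cannot get stuck since
   a minimal vertex outside a fixed point S would be added. *)
Require Import Defs.
From HB Require Import structures.
From mathcomp Require Import all_boot all_order all_algebra.
From Stdlib Require Import ClassicalEpsilon.
From mathcomp Require Import zify ring.
Set Implicit Arguments. Unset Strict Implicit. Unset Printing Implicit Defensive.
Import Order.TTheory GRing.Theory Num.Theory.

Lemma asboolP (P : Prop) : reflect P (asbool P).
Proof. by rewrite /asbool; case: excluded_middle_informative => h; constructor. Qed.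

Lemma pairwise_uniq_in (T : eqType) (r : rel T) (s : seq T) :
  uniq s -> {in s &, forall x y, x != y -> r x y} -> pairwise r s.
Proof.
elim: s => //= x s IH /andP[xs us] H; apply/andP; split.
  apply/allP => y ys; apply: H; rewrite ?inE ?eqxx ?ys ?orbT //.
  by apply: contraNneq xs => ->.
by apply: IH => // y z ys zs; apply: H; rewrite inE ?ys ?zs orbT.
Qed.

Lemma uniq_flatten_map (T : Type) (U : eqType) (g : T -> seq U) (s : seq T) :
  all (fun x => uniq (g x)) s ->
  pairwise (fun x y => ~~ has (mem (g x)) (g y)) s ->
  uniq (flatten (map g s)).
Proof.
elim: s => //= x s IH /andP[ux us] /andP[dx ps].
rewrite cat_uniq ux IH // andbT /=.
elim: s dx {IH us ps} => //= y s IH /andP[xy xs].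
by rewrite has_cat negb_or xy IH.
Qed.

(** * Hall's marriage theorem and its fractional form *)

Section Hall.
Variables (T U : finType).
Implicit Types (X A C : {set T}) (N : T -> {set U}).

Definition neighbours N A : {set U} := \bigcup_(x in A) N x.

(** Whatever [A] contributes is deleted with [B], so it may be joined to [C] freely. In the Hall
    induction [B] is the neighbourhood of a tight set [A], or a single matched vertex with [A]
    empty. *)
Lemma neighboursD N A C (B : {set U}) :
  neighbours N A \subset B ->
  neighbours (fun x => N x :\: B) C = neighbours N (C :|: A) :\: B.
Proof.
move=> /subsetP sAB; apply/setP=> u; rewrite inE; apply/bigcupP/andP.
  move=> [x xC]; rewrite inE => /andP[uB ux]; split=> //.
  by apply/bigcupP; exists x; rewrite // inE xC.
move=> [uB /bigcupP[x]]; rewrite inE => /orP[xC|xA] ux.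
  by exists x; rewrite // inE uB.
by case/negP: uB; apply: sAB; apply/bigcupP; exists x.
Qed.

(* Halmos-Vaughan induction: either split off a tight set, or match one
   vertex arbitrarily. *)
Lemma hall_in (u0 : U) X N :
  (forall A, A \subset X -> #|A| <= #|neighbours N A|) ->
  exists f : T -> U, {in X &, injective f} /\ {in X, forall x, f x \in N x}.
Proof.
have [n] := ubnP #|X|; elim: n X N => // n IH X N ltXn hallX.
have [->|/set0Pn[x xX]] := eqVneq X set0.
  by exists (fun=> u0); split=> [x y|x]; rewrite inE.
have [/existsP[A /and3P[AX A0 /eqP tight]]|] :=
  boolP [exists A : {set T},
    [&& A \proper X, A != set0 & #|neighbours N A| == #|A|]].
- have ltAX := proper_card AX.
  have [|f1 [f1i f1N]] := IH A N (leq_trans ltAX ltXn).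
    by move=> C CA; apply: hallX; apply: subset_trans CA (proper_sub AX).
  have cXA : #|X :\: A| < n.
    have := cardsID A X; rewrite (setIidPr (proper_sub AX)).
    by move: A0 ltXn; rewrite -card_gt0; lia.
  have [|f2 [f2i f2N]] := IH (X :\: A) (fun x => N x :\: neighbours N A) cXA.
    (* Hall's condition gives [C :|: A] at least [#|C| + #|A|] neighbours; the tight [A] accounts
       for exactly [#|A|] of them. *)
    move=> C CXA; rewrite (neighboursD C (subxx _)).
    have sAN : neighbours N A \subset neighbours N (C :|: A).
      by apply/bigcupsP => y yA; apply: bigcup_sup; rewrite inE yA orbT.
    have := cardsID (neighbours N A) (neighbours N (C :|: A)).
    rewrite (setIidPr sAN) tight.
    have CA0 : C :&: A = set0.
      apply/setP=> y; rewrite !inE; apply/negP=> /andP[/(subsetP CXA)].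
      by rewrite inE => /andP[/negbTE->].
    have := hallX (C :|: A); rewrite cardsU CA0 cards0 subUset (proper_sub AX).
    rewrite (subset_trans CXA (subsetDl _ _)) => /(_ isT); lia.
  exists (fun y => if y \in A then f1 y else f2 y); split=> [y z yX zX|y yX].
    have out t : t \in X -> t \notin A -> f2 t \notin neighbours N A.
      by move=> tX tA; have := f2N t; rewrite !inE tX tA => /(_ isT)/andP[].
    have inn t : t \in A -> f1 t \in neighbours N A.
      by move=> tA; apply/bigcupP; exists t => //; apply: f1N.
    case: ifP => yA; case: ifP => zA => E.
    + exact: f1i.
    + by have := out z zX (negbT zA); rewrite -E inn.
    + by have := out y yX (negbT yA); rewrite E inn.
    + by apply: f2i => //; rewrite inE ?yA ?zA.
  case: ifPn => yA; first exact: f1N.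
  by have := f2N y; rewrite !inE yA yX => /(_ isT)/andP[].
(* Every nonempty proper subset now has a neighbour to spare, so reserving one [u] for [x] preserves
   Hall's condition. *)
rewrite negb_exists => /forallP notight.
have [u uNx] : exists u, u \in N x.
  apply/set0Pn; rewrite -card_gt0; have := hallX [set x].
  by rewrite sub1set xX cards1 /neighbours big_set1 => /(_ isT).
have cX : #|X :\ x| < n by have := cardsD1 x X; rewrite xX; lia.
have [|f [fi fN]] := IH (X :\ x) (fun y => N y :\ u) cX.
  move=> C CX; have [->|C0] := eqVneq C set0; first by rewrite cards0.
  rewrite (@neighboursD N set0); last by rewrite /neighbours big_set0 sub0set.
  rewrite setU0.
  have CpX : C \proper X.
    apply/properP; split; first exact: subset_trans CX (subsetDl _ _).
    by exists x => //; apply/negP => /(subsetP CX); rewrite !inE eqxx.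
  have := notight C; rewrite CpX C0 /= => neq.
  have := hallX C (proper_sub CpX); have := cardsD1 u (neighbours N C).
  by move: neq; case: (u \in _); lia.
exists (fun y => if y == x then u else f y); split=> [y z yX zX|y yX].
  have neu t : t \in X -> t != x -> f t != u.
    by move=> tX tx; have := fN t; rewrite !inE tX tx => /(_ isT)/andP[].
  case: eqP => [->|/eqP yx]; case: eqP => [->|/eqP zx] // E.
  + by have := neu z zX zx; rewrite -E eqxx.
  + by have := neu y yX yx; rewrite E eqxx.
  + by apply: fi => //; rewrite !inE ?yx ?zx.
case: eqP => [->|/eqP yx] //.
by have := fN y; rewrite !inE yX yx => /(_ isT)/andP[].
Qed.

Local Open Scope ring_scope.

(** The rows in a set [A] carry mass [#|A|], all of it in columns of [neighbours _ A], and each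
    column holds at most 1: this is Hall's condition for the support of [M]. *)
Lemma fractional_matching (R : realFieldType) (u0 : U) (M : T -> U -> R) :
  (forall x u, 0 <= M x u) ->
  (forall x, \sum_u M x u = 1) -> (forall u, \sum_x M x u <= 1) ->
  exists f : T -> U, injective f /\ forall x, M x (f x) != 0.
Proof.
move=> M0 rowM colM.
have [|f [fi fN]] := @hall_in u0 setT (fun x => [set u | M x u != 0]).
  move=> A _; set N := neighbours _ A; rewrite -(ler_nat R).
  rewrite -sum1_card natr_sum.
  have -> : \sum_(x in A) 1%:R = \sum_(x in A) \sum_(u in N) M x u :> R.
    apply: eq_bigr => x xA; rewrite -[LHS](rowM x) (bigID (mem N)) /=.
    rewrite [X in _ + X]big1 ?addr0 // => u uN; apply/eqP.
    apply: contraNT uN => Mxu.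
    by apply/bigcupP; exists x; rewrite // inE.
  rewrite exchange_big -sum1_card natr_sum; apply: ler_sum => u _.
  apply: le_trans (colM u).
  by rewrite [leRHS](bigID (mem A)) /= lerDl sumr_ge0.
exists f; split=> [x y|x]; first by apply: fi; rewrite inE.
by have := fN x; rewrite !inE => /(_ isT).
Qed.
End Hall.

(** * Flows in the network and saturation of the sink edges *)

Section FlowNetwork.
Variables (m : nat) (D B : rel 'I_m).
Implicit Types (v a w : 'I_m) (A S Y : {set 'I_m}).

Definition Lnode a : fnode m := inr (inl a).
Definition Rnode w : fnode m := inr (inr w).

Lemma sum_fnode (V : nmodType) (F : fnode m -> V) :
  (\sum_x F x = F (fs m) + F (ft m)
     + (\sum_a F (Lnode a) + \sum_w F (Rnode w)))%R.
Proof. by rewrite big_sumType big_bool big_sumType. Qed.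

Section RealFlows.
Variable R : realFieldType.
Local Open Scope ring_scope.

(** Total outflow equals total inflow over all nodes, and conservation cancels everything except [s]
    and [t]; no edge enters [s] or leaves [t]. *)
Lemma flow_size_into_sink v A (f : fnode m -> fnode m -> R) :
  is_flow D B v A f ->
  flow_size f = \sum_(w in pa D v) f (Rnode w) (ft m).
Proof.
move=> [f0 fE fC].
have : \sum_x \sum_y f x y = \sum_x \sum_y f y x by apply: exchange_big.
rewrite (sum_fnode (fun x => \sum_y f x y)) (sum_fnode (fun x => \sum_y f y x)).
rewrite [X in _ + X = _](_ : _ =
    (\sum_a \sum_y f y (Lnode a) + \sum_w \sum_y f y (Rnode w))); last first.
  by congr (_ + _); apply: eq_bigr => a _; [case: (fC (Lnode a) isT isT)|case: (fC (Rnode a) isT isT)].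
move/addIr.
rewrite [\sum_y f (ft m) y]big1 => [|y _]; last by apply: fE.
rewrite [\sum_y f y (fs m)]big1 => [|y _]; last first.
  by apply: fE; case: y => [[]|[]].
rewrite addr0 add0r /flow_size => ->.
rewrite sum_fnode !fE // !add0r big1 ?add0r => [|a _]; last exact: fE.
rewrite (bigID (mem (pa D v))) /= addrC big1 ?add0r // => w wP.
exact: fE.
Qed.

Lemma flow_to_sink_le1 v A (f : fnode m -> fnode m -> R) w :
  is_flow D B v A f -> f (Rnode w) (ft m) <= 1.
Proof.
move=> [f0 _ fC]; have [_ ] := fC (Rnode w) isT isT; apply: le_trans.
by rewrite (bigD1 (ft m)) //= lerDl sumr_ge0.
Qed.

Lemma flow_size_le v A (f : fnode m -> fnode m -> R) :
  is_flow D B v A f -> flow_size f <= #|pa D v|%:R.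
Proof.
move=> fl; rewrite (flow_size_into_sink fl) -sum1_card natr_sum.
by apply: ler_sum => w _; apply: flow_to_sink_le1 fl.
Qed.

(** The deficits [1 - f (Rnode w) (ft m)] over [pa D v] are nonnegative and sum to zero. *)
Lemma saturated_sink v A (f : fnode m -> fnode m -> R) w :
  is_flow D B v A f -> flow_size f = #|pa D v|%:R ->
  w \in pa D v -> f (Rnode w) (ft m) = 1.
Proof.
move=> fl; rewrite (flow_size_into_sink fl) -sum1_card natr_sum => E wP.
apply/esym/eqP; rewrite -subr_eq0; apply/eqP.
move: w wP; apply: psumr_eq0P => [u _|].
  by rewrite subr_ge0; apply: flow_to_sink_le1 fl.
by rewrite sumrB E subrr.
Qed.

(* M u x is the flow from x into R(u); a node R(u) carrying flow less than 1
   sends the remainder to itself, so that each M u sums to 1, while M u (R(w))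
   vanishes for the saturated w in pa v. *)
Lemma saturating_flow_linkage v A (f : fnode m -> fnode m -> R) :
  is_flow D B v A f -> flow_size f = #|pa D v|%:R ->
  exists g : 'I_m -> 'I_m + 'I_m, injective g /\
    forall u, match g u with
              | inl w => (w \notin pa D v) && ((w == u) || D w u)
              | inr a => (a \in A) && ((a == u) || B a u)
              end.
Proof.
move=> fl sz; have [f0 fE fC] := fl.
pose thru u := \sum_y f (Rnode u) y.
have thru1 u : thru u <= 1 by case: (fC (Rnode u) isT isT).
pose M u (x : 'I_m + 'I_m) := match x with
  | inl w => f (Rnode w) (Rnode u) + (1 - thru u) *+ (w == u)
  | inr a => f (Lnode a) (Rnode u) end.
have M0 u x : 0 <= M u x.
  by case: x => [w|a] //=; rewrite addr_ge0 // mulrn_wge0 // subr_ge0.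
have deltaR w (c : 'I_m -> R) : \sum_u c u *+ (w == u) = c w.
  rewrite (bigD1 w) //= eqxx big1 ?addr0 // => u.
  by rewrite eq_sym => /negbTE->.
(* The slack [1 - thru w] cancels the outflow of [R(w)] up to the part sent to [t], so the column
   vanishes when the sink edge is saturated. *)
have colM w : \sum_u M u (inl w) = 1 - f (Rnode w) (ft m).
  rewrite /= big_split /= (deltaR w (fun i => 1 - thru i)) {1}/thru sum_fnode.
  rewrite fE // add0r [\sum_a f _ (Lnode a)]big1 => [|a _]; last exact: fE.
  by ring.
have [u|x|g [gi gM]] := @fractional_matching _ _ R (inl v) M M0.
- rewrite big_sumType /= big_split /=.
  rewrite [\sum_w _ *+ (w == u)](_ : _ = 1 - thru u); last first.
    rewrite -[RHS](deltaR u (fun=> 1 - thru u)); apply: eq_bigr => w _.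
    by rewrite eq_sym; case: eqP => [->|].
  have [+ _] := fC (Rnode u) isT isT.
  by rewrite sum_fnode !fE //= !add0r -/(thru u) => <-; ring.
- case: x => [w|a]; first by rewrite colM gerBl.
  apply: le_trans (_ : \sum_y f (Lnode a) y <= 1); last first.
    by case: (fC (Lnode a) isT isT).
  by rewrite sum_fnode /= addrA lerDr !addr_ge0 ?sumr_ge0.
exists g; split=> // u; have := gM u; case: (g u) => [w|a] /=.
  move=> nz; apply/andP; split; last first.
    apply: contraNT nz; rewrite negb_or => /andP[/negbTE-> nD].
    by rewrite fE //= addr0.
  apply: contraNN nz => wP; apply/eqP.
  have := colM w; rewrite (saturated_sink fl sz wP) subrr => E.
  exact: (@psumr_eq0P R _ xpredT (fun u => M u (inl w)) (fun u _ => M0 u _) E).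
by move=> nz; apply: contraNT nz => nE; rewrite fE.
Qed.

End RealFlows.

(** * Half-treks extracted from an injective linkage *)

Lemma halftrek_of_path a x r :
  (a == x) || B a x -> path D x r ->
  exists h, [/\ is_halftrek D B h, ht_src h = a, ht_right h = x :: r
              & ht_tgt h = last x r].
Proof.
move=> ax Dr; have [->|nax] := eqVneq a x; first by exists (HalfTrek x false r).
exists (HalfTrek a true (x :: r)); split=> //.
by move: ax; rewrite (negbTE nax) /is_halftrek /= => ->.
Qed.

(** This merges the two forms of half-trek: a directed walk entered from the source by equality or
    by a bidirected edge, just like the edges [L(a) -> R(x)]. *)
Lemma halftrek_right_path h :
  is_halftrek D B h ->
  exists x r, [/\ ht_right h = x :: r, (ht_src h == x) || B (ht_src h) x,
                  path D x r & ht_tgt h = last x r].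
Proof.
case: h => a [] [|x r] //=; rewrite /is_halftrek /=.
- by move=> /andP[ax Dr]; exists x, r; rewrite /ht_right /= ax orbT.
- by move=> _; exists a, [::]; rewrite eqxx.
- by move=> /andP[ax Dr]; exists a, (x :: r); rewrite /= eqxx ax.
Qed.

(* Tracing g backwards from a point of P cannot cycle, since g is injective
   and P is not hit, so it ends in A; distinct traces cannot merge. *)
Lemma linkage_halftreks (P A : {set 'I_m}) (g : 'I_m -> 'I_m + 'I_m) :
  injective g ->
  (forall u, match g u with
             | inl w => (w \notin P) && ((w == u) || D w u)
             | inr a => (a \in A) && ((a == u) || B a u)
             end) ->
  exists2 Y : {set 'I_m}, Y \subset A /\ #|Y| = #|P| &
    exists hs, ht_system D B hs Y P.
Proof.
(* [e x y] says that [y] is traced back to [x]; the fixed points [g y = inl y] are left out, so each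
   [e]-step is a directed edge. *)
move=> gi gP; pose e := [rel x y | (g y == inl x) && (x != y)].
have eP x y : e x y -> x \notin P.
  by move=> /andP[/eqP gy _]; have := gP y; rewrite gy => /andP[].
have eD : subrel e D.
  move=> x y /= /andP[/eqP gy xy].
  by have := gP y; rewrite gy (negbTE xy) => /andP[].
have einj x y z : e x y -> e x z -> y = z.
  by move=> /andP[/eqP gy _] /andP[/eqP gz _]; apply: gi; rewrite gy gz.
(* By injectivity of [g] a node has at most one [e]-successor, and points of [P] have none, so [x]
   reaches at most one point of [P]. *)
have meet x p q : p \in P -> q \in P -> connect e x p -> connect e x q -> p = q.
  move=> pP qP /connectP[r er Ep] /connectP[r' er' Eq].
  elim: r x r' er er' Ep Eq => [|y r IH] x [|y' r'] /=.
  - by move=> _ _ -> ->.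
  - by move=> _ /andP[/eP + _] Ep; rewrite -Ep pP.
  - by move=> /andP[/eP + _] _ _ Eq; rewrite -Eq qP.
  - move=> /andP[xy er] /andP[xy' er'].
    by rewrite -(einj _ _ _ xy xy') in er' *; apply: IH.
have start p : p \in P -> exists2 x, connect e x p & exists a, g x = inr a.
  move=> pP.
  have [//|none] := asboolP (exists2 x, connect e x p & exists a, g x = inr a).
  (* If no ancestor of [p] is sent to an [inr], then [h] maps the ancestor set [C] injectively into
     [C :\ p], contradicting cardinality. *)
  pose C := [set x | connect e x p].
  pose h x := if g x is inl w then w else x.
  have gh x : x \in C -> g x = inl (h x).
    rewrite inE /h => xp; case E: (g x) => [//|a].
    by case: none; exists x => //; exists a.
  have hC x : x \in C -> h x \in C :\ p.
    move=> xC; have gx := gh x xC; have := gP x; rewrite gx => /andP[hP _].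
    rewrite !inE; apply/andP; split; first by apply: contraNneq hP => ->.
    have [->|hx] := eqVneq (h x) x; first by move: xC; rewrite inE.
    move: xC; rewrite inE; apply: connect_trans; apply: connect1.
    by rewrite /= gx eqxx hx.
  have hi : {in C &, injective h}.
    by move=> x y xC yC E; apply: gi; rewrite !gh // E.
  have: h @: C \subset C :\ p by apply/subsetP => _ /imsetP[x xC ->]; apply: hC.
  move/subset_leq_card; rewrite card_in_imset //.
  by rewrite (cardsD1 p C) inE connect0 ltnn.
have to_end x r : path e x r -> {in x :: r, forall y, connect e y (last x r)}.
  move=> er y yr; case/splitPl: r / yr er => r1 r2 Ey.
  rewrite cat_path last_cat Ey => /andP[_ er2].
  by apply/connectP; exists r2.
(* Stated as an implication so that the choice of half-treks becomes a total function [H], with a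
   dummy value off [P]. *)
have trek p : exists h, p \in P ->
    [/\ is_halftrek D B h, ht_tgt h = p, ht_src h \in A,
        exists2 x, x \in ht_right h & g x = inr (ht_src h)
      & {in ht_right h, forall y, connect e y p}].
  have [pP|] := boolP (p \in P); last by exists (HalfTrek p false [::]).
  have [x /connectP[r er Ep] [a gx]] := start p pP.
  have := gP x; rewrite gx => /andP[aA ax].
  have [h [hh hs hr ht]] := halftrek_of_path ax (sub_path eD er).
  exists h => _; rewrite hr hs ht; split=> //; first by exists x; rewrite ?mem_head.
  by rewrite Ep; apply: to_end.
have [H HP] := fin_all_exists trek.
have HPe p : p \in enum P -> p \in P by rewrite mem_enum.
(* Equal sources force, by injectivity of [g], a common node on both right sides; it reaches both
   targets, which [meet] then identifies. *)
have srci : {in P &, injective (fun p => ht_src (H p))}.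
  move=> p q pP qP E; have [_ _ _ [x xp gx] cp] := HP p pP.
  have [_ _ _ [y yq gy] cq] := HP q qP.
  have xy : x = y by apply: gi; rewrite gx gy E.
  by apply: (meet x) => //; [apply: cp|rewrite xy; apply: cq].
exists [set ht_src (H p) | p in P].
  split; last by rewrite card_in_imset.
  by apply/subsetP => _ /imsetP[p pP ->]; case: (HP p pP).
exists [seq H p | p <- enum P]; split.
  by rewrite all_map; apply/allP => p /HPe/HP[].
have tgtE : [seq ht_tgt h | h <- [seq H p | p <- enum P]] = enum P.
  rewrite -map_comp -[RHS]map_id; apply/eq_in_map => p /HPe/HP[] //.
rewrite tgtE enum_uniq -map_comp map_inj_in_uniq ?enum_uniq; last first.
  by move=> p q /HPe + /HPe; apply: srci.
do !split=> //.
- apply/setP=> x; rewrite inE; apply/mapP/imsetP => -[p pP ->]; exists p => //.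
  + exact: HPe.
  + by rewrite mem_enum.
- by apply/setP=> x; rewrite inE mem_enum.
- rewrite pairwise_map; apply: pairwise_uniq_in (enum_uniq _) _.
  move=> p q /HPe pP /HPe qP pq /=; apply/andP; split.
    rewrite disjoint_has /= orbF inE; apply: contraNN pq => /eqP E.
    by apply/eqP/srci.
  rewrite disjoint_has; apply/hasPn => x xp; apply: contraNN pq => xq.
  have [_ _ _ _ cp] := HP p pP; have [_ _ _ _ cq] := HP q qP.
  by rewrite (meet x p q) // ?cp ?cq.
Qed.

(** * Flows built from systems of half-treks *)

Lemma count_behead_belast (T : eqType) (s t x : T) (p : seq T) :
  last s p = t -> x != s -> x != t ->
  count_mem x p = count_mem x (belast s p).
Proof.
move=> <- /negbTE xs /negbTE xt.
have := congr1 (count_mem x) (lastI s p).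
by rewrite -cats1 count_cat /= ![_ == x]eq_sym xs xt add0n !addn0.
Qed.

Lemma walk_steps (T : eqType) (e : rel T) x p :
  path e x p -> {in zip (belast x p) p, forall q, e q.1 q.2}.
Proof.
elim: p x => //= y p IH x /andP[xy py] q.
by rewrite inE => /orP[/eqP->//|]; apply: IH.
Qed.

Lemma sum_count_fst (T1 T2 : finType) (s : seq (T1 * T2)) x :
  \sum_y count_mem (x, y) s = count_mem x (unzip1 s).
Proof.
elim: s => [|[a b] s IH]; first by rewrite big1.
rewrite /= big_split /= IH; congr (_ + _)%N; rewrite (bigD1 b) //= big1.
  by rewrite xpair_eqE eqxx andbT addn0.
by move=> y yb; rewrite xpair_eqE [b == y]eq_sym (negbTE yb) andbF.
Qed.

Lemma sum_count_snd (T1 T2 : finType) (s : seq (T1 * T2)) y :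
  \sum_x count_mem (x, y) s = count_mem y (unzip2 s).
Proof.
elim: s => [|[a b] s IH]; first by rewrite big1.
rewrite /= big_split /= IH; congr (_ + _)%N; rewrite (bigD1 a) //= big1.
  by rewrite xpair_eqE eqxx addn0.
by move=> x xa; rewrite xpair_eqE [a == x]eq_sym (negbTE xa).
Qed.

(** The flow on an edge is the number of times the walks traverse it. Each visit to an inner node
    enters and leaves it once, whence conservation. *)
Lemma walks_flow (R : realFieldType) v A (W : seq (seq (fnode m))) :
  {in W, forall p, path (fedge D B v A) (fs m) p /\ last (fs m) p = ft m} ->
  (forall x, x != fs m -> x != ft m -> \sum_(p <- W) count_mem x p <= 1) ->
  exists f : fnode m -> fnode m -> R, is_flow D B v A f /\
    flow_size f = (\sum_(p <- W) count_mem (fs m) (belast (fs m) p))%:R%R.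
Proof.
move=> HW cap; pose steps p := zip (belast (fs m) p) p.
pose f x y : R := ((\sum_(p <- W) count_mem (x, y) (steps p))%:R)%R.
have out x : (\sum_y f x y = (\sum_(p <- W) count_mem x (belast (fs m) p))%:R)%R.
  rewrite -natr_sum exchange_big; congr (_%:R)%R; apply: eq_bigr => p _.
  by rewrite sum_count_fst unzip1_zip // size_belast.
have inn y : (\sum_x f x y = (\sum_(p <- W) count_mem y p)%:R)%R.
  rewrite -natr_sum exchange_big; congr (_%:R)%R; apply: eq_bigr => p _.
  by rewrite sum_count_snd unzip2_zip // size_belast.
exists f; split; last exact: out.
split=> [x y|x y nxy|x xs xt]; first exact: ler0n.
  rewrite /f big_seq big1 // => p /HW[pp _]; apply/count_memPn.
  by apply: contraNN nxy => /(walk_steps pp).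
have -> : (\sum_w f x w = \sum_u f u x)%R.
  rewrite out inn; congr (_%:R)%R; apply: eq_big_seq => p /HW[_ pt].
  by rewrite (count_behead_belast pt).
by rewrite inn; split=> //; rewrite (ler_nat R _ 1); apply: cap.
Qed.

(** A half-trek may repeat nodes, which would violate the node capacity 1; removing the loops keeps
    both ends of the right side. *)
Definition trail (h : halftrek m) : seq 'I_m :=
  if ht_right h is x :: r then x :: shorten x r else [::].

Lemma trailP h :
  is_halftrek D B h ->
  exists x r, [/\ trail h = x :: r, (ht_src h == x) || B (ht_src h) x,
                  path D x r & last x r = ht_tgt h] /\
              uniq (trail h) /\ {subset trail h <= ht_right h}.
Proof.
move=> /halftrek_right_path[x [r [hr ax Dr ->]]].
rewrite /trail hr; case/shortenP: Dr => r' Dr' ur' sr'.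
exists x, r'; split=> //; split=> // y; rewrite !inE.
by case: eqP => //= _ /sr'.
Qed.

Definition trek_walk (h : halftrek m) : seq (fnode m) :=
  Lnode (ht_src h) :: rcons (map Rnode (trail h)) (ft m).

Lemma trek_walk_path v A h :
  is_halftrek D B h -> ht_src h \in A -> ht_tgt h \in pa D v ->
  path (fedge D B v A) (fs m) (trek_walk h) /\
  last (fs m) (trek_walk h) = ft m.
Proof.
move=> /trailP[x [r [[tr ax Dr ht] _]]] aA tP.
split; last by rewrite /trek_walk /= last_rcons.
rewrite /trek_walk tr /= aA ax /= rcons_path last_map path_map ht /= tP andbT.
by rewrite (sub_path _ Dr).
Qed.

(** Distinct sources bound the visits to each [L(a)] by one; disjoint right sides and
    repetition-free trails do so for each [R(u)]. *)
Lemma system_flow (R : realFieldType) v A Y hs :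
  ht_system D B hs Y (pa D v) -> Y \subset A ->
  exists f : fnode m -> fnode m -> R, is_flow D B v A f /\
    flow_size f = (#|pa D v|%:R)%R.
Proof.
move=> [hh [us [sY [ut [tP pd]]]]] /subsetP YA.
have srcs x : x \in map (@ht_src m) hs -> x \in A.
  by move=> xs; apply: YA; rewrite -sY inE.
have tgts x : x \in map (@ht_tgt m) hs -> x \in pa D v by rewrite -tP inE.
have HW : {in map trek_walk hs, forall p,
    path (fedge D B v A) (fs m) p /\ last (fs m) p = ft m}.
  move=> p; elim: hs hh srcs tgts {us sY ut tP pd} => //= h hs IH.
  move=> /andP[hh hhs] srcs tgts; rewrite inE => /orP[/eqP->|].
    by apply: trek_walk_path; [|apply: srcs|apply: tgts]; rewrite ?mem_head.
  by apply: IH => // x xh; [apply: srcs|apply: tgts]; rewrite inE xh orbT.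
have [|f [fl sz]] := @walks_flow R v A _ HW.
  move=> x xs xt; rewrite big_map.
  case: x xs xt => [[]|[a|u]] // _ _.
    rewrite (eq_bigr (fun h => (ht_src h == a) + 0)) => [|h _].
      rewrite big_split /= big1_eq addn0.
      have -> : \sum_(h <- hs) (ht_src h == a) = count_mem a (map (@ht_src m) hs).
        by rewrite count_map -sum1_count [RHS]big_mkcond; apply: eq_bigr => h _ /=; case: eqP.
      by rewrite count_uniq_mem ?leq_b1.
    rewrite /trek_walk /= -cats1 count_cat count_map /=.
    by rewrite (@eq_count _ _ pred0) ?count_pred0.
  have -> : \sum_(h <- hs) count_mem (Rnode u) (trek_walk h) =
            count_mem u (flatten (map trail hs)).
    rewrite count_flatten sumnE !big_map; apply: eq_bigr => h _.
    rewrite /trek_walk /= -cats1 count_cat count_map /= add0n !addn0.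
    exact: eq_count.
  rewrite count_uniq_mem ?leq_b1 //; apply: uniq_flatten_map.
    by apply: sub_all hh => h /trailP[? [? [_ []]]].
  elim: hs hh pd {us sY ut tP srcs tgts HW} => //= h hs IH /andP[hh hhs].
  move=> /andP[ph phs]; rewrite IH // andbT.
  elim: hs hhs ph {IH phs} => //= h' hs IH /andP[hh' hhs] /andP[/andP[_ d] ph].
  rewrite IH // andbT; apply/hasPn => y yh'; apply/negP => yh.
  have [_ [_ [_ [_ sh]]]] := trailP hh; have [_ [_ [_ [_ sh']]]] := trailP hh'.
  by move/pred0P/(_ y): d; rewrite /= sh // sh'.
exists f; split=> //; rewrite sz big_map; congr (_%:R)%R.
(* Each walk leaves [s] exactly once, and there are as many walks as targets. *)
rewrite (eq_bigr (fun=> 1%N)) => [|h _].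
  by rewrite sum1_size -tP cardsE (card_uniqP ut) size_map.
rewrite /trek_walk /= belast_rcons /= count_map.
by rewrite (@eq_count _ _ pred0) ?count_pred0.
Qed.
(** Maximality is automatic by [flow_size_le], so only the existence of a saturating flow is at
    stake. *)
Lemma max_flow_system (R : realFieldType) v A :
  max_flow_is D B R v A #|pa D v| <->
  exists2 Y : {set 'I_m}, Y \subset A /\ #|Y| = #|pa D v| &
    exists hs, ht_system D B hs Y (pa D v).
Proof.
split=> [[[f [fl sz]] _]|[Y [YA _] [hs /system_flow sys]]].
  have [g [gi gP]] := saturating_flow_linkage fl sz.
  exact: linkage_halftreks gi gP.
by split; [apply: sys|move=> f; apply: flow_size_le].
Qed.

End FlowNetwork.

(** * The procedure and HTC-identifiability *)

Section Procedure.
Variables (R : realFieldType) (m : nat) (D B : rel 'I_m).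
Implicit Types (v w : 'I_m) (S : {set 'I_m}).

Let step := alg_step D B R.
Let pass := alg_pass D B R.

Lemma alg_step_sub S v : S \subset step S v.
Proof.
by rewrite /step /alg_step; case: ifP => // _; case: ifP => // _; exact: subsetUr.
Qed.

Lemma foldl_step_sub S (s : seq 'I_m) : S \subset foldl step S s.
Proof.
elim: s S => //= v s IH S; exact: subset_trans (alg_step_sub S v) (IH _).
Qed.

(** Steps never shrink [S], so a pass that returns [S] has [S] at every intermediate stage. *)
Lemma alg_pass_fixed S v : pass S = S -> step S v = S.
Proof.
rewrite /pass /alg_pass => E; have: v \in enum 'I_m by rewrite mem_enum.
elim: (enum 'I_m) E => //= w s IH E; rewrite -/step in E IH *.
have Ew : step S w = S.
  apply/eqP; rewrite eqEsubset alg_step_sub andbT.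
  by have := foldl_step_sub (step S w) s; rewrite E.
by rewrite inE => /orP[/eqP->//|]; apply: IH; rewrite Ew in E.
Qed.

Lemma iter_pass_fixed S : exists k, pass (iter k pass S) = iter k pass S.
Proof.
(* Every pass that changes the set adds a vertex, so [m + 1] such passes would yield more than [m]
   vertices. *)
suff H n : (exists k, pass (iter k pass S) = iter k pass S) \/
           n <= #|iter n pass S|.
  have [//|] := H #|'I_m|.+1.
  by rewrite leqNgt ltnS max_card.
elim: n => [|n [IH|IH]]; [by right|by left|].
have [E|ne] := eqVneq (pass (iter n pass S)) (iter n pass S).
  by left; exists n.
right; apply: leq_ltn_trans IH _; apply: proper_card.
by rewrite properEneq eq_sym ne foldl_step_sub.
Qed.

(* The list records the order in which vertices enter S. *)
Definition witnessed (S : {set 'I_m}) : Prop :=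
  exists l : seq 'I_m, S = [set x in l] /\
    forall v, v \in l -> exists2 Y, htc D B v Y &
      forall w, w \in Y :&: htr D B v -> index w l < index v l.

(** Vertices without parents are served by the empty system, so any order among them will do. *)
Lemma witnessed_init : witnessed (alg_init D).
Proof.
exists (enum (alg_init D)); split=> [|v].
  by apply/setP=> x; rewrite [RHS]inE mem_enum.
rewrite mem_enum inE => /eqP pv; exists set0 => [|w]; last by rewrite !inE.
split; rewrite ?pv ?set0I // ; exists [::]; rewrite /ht_system /=.
by do !split=> //; apply/setP=> x; rewrite !inE.
Qed.

(** Members of [algA D B S v] lying in [htr D B v] are already in [S]; appending [v] places it after
    them and keeps all old indices. *)
Lemma witnessed_step S v : witnessed S -> witnessed (step S v).
Proof.
move=> [l [SE lP]]; rewrite /step /alg_step.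
case: ifP => vS; first by exists l.
case: asboolP => [/max_flow_system[Y [YA cY] sysY]|_]; last by exists l.
have vl : v \notin l by move: vS; rewrite SE inE => ->.
exists (rcons l v); split=> [|u].
  by rewrite SE; apply/setP=> x; rewrite !inE mem_rcons inE.
rewrite mem_rcons inE => /orP[/eqP->|ul].
  exists Y => [|w].
    split=> //; apply/setP=> x; rewrite in_set0; apply/negP.
    rewrite inE => /andP[/(subsetP YA)].
    by rewrite inE => /andP[/negbTE->].
  rewrite inE => /andP[/(subsetP YA)].
  rewrite !inE SE !inE => /andP[_ /orP[wl|/negbTE->//]] _.
  by rewrite -cats1 !index_cat wl (negbTE vl) /= eqxx addn0 index_mem.
have [Z hZ Zl] := lP u ul; exists Z => // w /Zl lt.
have wl : w \in l by rewrite -index_mem (ltn_trans lt) // index_mem.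
by rewrite -cats1 !index_cat wl ul.
Qed.

Lemma witnessed_iter_pass k : witnessed (iter k pass (alg_init D)).
Proof.
elim: k => [|k IH] /=; first exact: witnessed_init.
rewrite {1}/pass /alg_pass; elim: (enum 'I_m) (iter k _ _) IH => //= v s IH S wS.
by apply: IH; apply: witnessed_step.
Qed.

Lemma witnessed_identifiable : witnessed setT -> HTC_identifiable D B.
Proof.
move=> [l [lT lP]]; have inl v : v \in l by have := in_setT v; rewrite lT inE.
have [Ys YsP] : exists Ys : 'I_m -> {set 'I_m}, forall v, htc D B v (Ys v) /\
    forall w, w \in Ys v :&: htr D B v -> index w l < index v l.
  apply: (@fin_all_exists _ _ (fun v Y => htc D B v Y /\
    forall w, w \in Y :&: htr D B v -> index w l < index v l)) => v.
  by have [Y] := lP v (inl v); exists Y.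
exists Ys; split=> [v|]; first by case: (YsP v).
exists [rel x y | index x l < index y l]; split=> [x|y x z|x y|v w] /=.
- by rewrite ltnn.
- exact: ltn_trans.
- by rewrite -neq_ltn; apply: contraNneq => /index_inj-> //; exact: inl.
- by move=> wY; have [_] := YsP v; apply.
Qed.

Lemma identifiable_fixed S :
  HTC_identifiable D B -> pass S = S -> S = setT.
Proof.
move=> [Ys [Yhtc [lt [ltxx lt_trans _ ltY]]]] fixS; apply/eqP/negPn/negP.
rewrite -subTset => /subsetPn[v0 _ v0S].
(* Minimising the number of [lt]-predecessors gives an [lt]-minimal vertex outside [S]: along [lt]
   the predecessor sets grow strictly. *)
have [v vS vmin] := @arg_minnP _ v0 (fun v => v \notin S)
  (fun v => #|[set w | lt w v]|) v0S.
have below w : lt w v -> w \in S.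
  move=> wv; apply/negPn/negP => wS; have := vmin w wS; apply/negP.
  rewrite -ltnNge; apply/proper_card/properP; split.
    by apply/subsetP=> x; rewrite !inE => xw; apply: lt_trans xw wv.
  by exists w; rewrite inE ?ltxx.
have [cY disY [hs sys]] := Yhtc v.
have YA : Ys v \subset algA D B S v.
  apply/subsetP=> w wY; rewrite /algA in_setD; apply/andP; split.
    by apply/negP=> wv; have := in_set0 w; rewrite -disY in_setI wY wv.
  rewrite in_setU in_setC; case: (boolP (w \in htr D B v)) => wh; last by rewrite orbT.
  by rewrite below // ltY // inE wY.
have := alg_pass_fixed v fixS; rewrite /step /alg_step (negbTE vS).
case: asboolP => [_ E|[]]; last first.
  by apply/max_flow_system; exists (Ys v); [split|exists hs].
by have := setU11 v S; rewrite E (negbTE vS).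
Qed.

End Procedure.

Theorem mainTheorem9 (R : realFieldType) (m : nat) (D B : rel 'I_m)
  (HDirr : irreflexive D) (HBirr : irreflexive B) (HBsym : symmetric B) :
  HTC_identifiable D B <-> @procedure_succeeds m D B R.
Proof.
split=> [ident|[k [kT _]]]; last first.
  by apply: witnessed_identifiable; rewrite -kT; apply: witnessed_iter_pass.
have [k0 fix0] := iter_pass_fixed R D B (alg_init D).
pose fixed k := alg_pass D B R (iter k (alg_pass D B R) (alg_init D)) ==
                iter k (alg_pass D B R) (alg_init D).
(* The least stationary iterate is taken because every earlier pass has to change [S]. *)
have [|k /eqP fixk kmin] := @ex_minnP fixed; first by exists k0; apply/eqP.
exists k; split; first exact: identifiable_fixed fixk.
by move=> j; apply: contraTN => /kmin; rewrite -leqNgt.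
Qed.
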